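(* For every integer $k \ge 1$, there exists a periodic identifying code $C^*$ in the strip $S_k$, with pattern length $l \le 2^{4k}$, such that the density $d(C^*,S_k)$ exists and equals $d^*(S_k)$.
   Context: For $k\ge 1$, the strip $S_k$ is the subgraph of the square grid (vertex set $\mathbb{Z}^2$, edges between points at Euclidean distance $1$) induced by $\mathbb{Z}\times\{0,\ldots,k-1\}$. For a vertex $v$ of a graph $G$, $N[v]$ denotes its closed neighborhood ($v$ together with its neighbors). A set $C\subseteq V(G)$ is an identifying code of $G$ if $N[v]\cap C\neq\emptyset$ for every vertex $v$, and $N[u]\cap C\neq N[v]\cap C$ for every pair of distinct vertices $u,v$. Fix a vertex $v_0$ and let $B_r(v_0)$ be the set of vertices at graph distance at most $r$ from $v_0$. The upper density of $C$ is $\overline{d}(C,G)=\limsup_{r\to\infty}|C\cap B_r(v_0)|/|B_r(v_0)|$; the lower density is the corresponding $\liminf$, and when they coincide their common value is the density $d(C,G)$. The infimum density is $d^*(G)=\inf_C \overline{d}(C,G)$ over all identifying codes $C$ of $G$. A periodic identifying code in $S_k$ with pattern length $l\ge1$ is an identifying code $C$ invariant under the translation $(x,y)\mapsto(x+l,y)$; it is obtained by repeating its restriction to $l$ consecutive columns (a bar pattern), and its density is $|C\cap(\{0,\ldots,l-1\}\times\{0,\ldots,k-1\})|/(lk)$. *)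

(* Defs.v *)
From mathcomp Require Import all_boot all_order all_algebra.
From mathcomp Require Import finmap.
From mathcomp Require Import boolp classical_sets functions cardinality reals.
From mathcomp Require Import topology normedtype sequences.

Set Implicit Arguments.
Unset Strict Implicit.
Unset Printing Implicit Defensive.

Import Order.TTheory GRing.Theory Num.Theory.

Local Open Scope classical_set_scope.
Local Open Scope ring_scope.

Section Graph.
Variables (V : choiceType) (adj : rel V).

Definition closed_nbhd (v : V) : set V := [set u | u = v \/ adj v u].

Definition identifying_code (C : set V) : Prop :=
  (forall v, closed_nbhd v `&` C !=set0) /\
  (forall u v, u <> v -> closed_nbhd u `&` C <> closed_nbhd v `&` C).

(* Graph distance at most r means that some walk of length at most r joins
   the two vertices. *)
Definition graph_ball (v0 : V) (r : nat) : set V :=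
  [set v | exists p : seq V,
     [/\ path adj v0 p, last v0 p = v & (size p <= r)%N]].

(* fset_set is only meaningful on finite sets; balls are finite in a locally
   finite graph. *)
Definition ball_ratio (R : realType) (v0 : V) (C : set V) (r : nat) : R :=
  #|` fset_set (C `&` graph_ball v0 r)|%:R / #|` fset_set (graph_ball v0 r)|%:R.

Definition upper_density (R : realType) (v0 : V) (C : set V) : R :=
  limn_sup (ball_ratio R v0 C).

Definition lower_density (R : realType) (v0 : V) (C : set V) : R :=
  limn_inf (ball_ratio R v0 C).

Definition has_density (R : realType) (v0 : V) (C : set V) (d : R) : Prop :=
  upper_density R v0 C = d /\ lower_density R v0 C = d.

(* The real-valued inf is meaningful as soon as the graph has an identifying
   code: upper densities lie in [0, 1]. *)
Definition infimum_density (R : realType) (v0 : V) : R :=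
  inf [set upper_density R v0 C | C in [set C | identifying_code C]].

End Graph.

(* Euclidean distance 1, tested on the squared distance to stay in int. *)
Definition grid_adj : rel (int * int) :=
  fun p q => (p.1 - q.1) ^+ 2 + (p.2 - q.2) ^+ 2 == 1.

Definition strip_point (k : nat) (v : int * 'I_k) : int * int :=
  (v.1, (v.2 : nat)%:Z).

Definition strip_adj (k : nat) : rel (int * 'I_k) :=
  fun u v => grid_adj (strip_point u) (strip_point v).

Definition strip_shift (k l : nat) (v : int * 'I_k) : int * 'I_k :=
  (v.1 + l%:Z, v.2).

Definition periodic_identifying_code (k l : nat) (C : set (int * 'I_k)) : Prop :=
  [/\ (1 <= l)%N, identifying_code (@strip_adj k) C
    & strip_shift l @` C = C].

(* Main.v *)
Require Import Defs.
From mathcomp Require Import all_boot all_order all_algebra.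
From mathcomp Require Import boolp classical_sets reals.
From mathcomp Require Import zify lra finmap.
From mathcomp Require Import cardinality topology normedtype sequences.

(* Whether a set of vertices is an identifying code can be read off its windows
   of five consecutive columns: two vertices whose columns differ by at least
   three are separated as soon as they are dominated.  So identifying codes are
   the bi-infinite walks of a digraph on the 2^(4k) subsets of a window of four
   columns, two overlapping windows being joined when some identifying code
   shows them consecutively.  Repeating a simple cycle gives a periodic code of
   period at most 2^(4k).  If m is the least mean number of code vertices per
   column over the simple cycles, loop erasure shows that n consecutive columns
   of any identifying code contain at least m (n - 2^(4k)) code vertices, and an
   optimal cycle attains the density m / k. *)

Set Implicit Arguments.
Unset Strict Implicit.
Unset Printing Implicit Defensive.

Import Order.TTheory GRing.Theory Num.Theory.
Import numFieldNormedType.Exports.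

Local Open Scope classical_set_scope.
Local Open Scope ring_scope.

(** * Cycles and walks in a finite weighted digraph *)

(** Induction on the walk: once the tail is reduced to a simple path, a return to [x] closes a
    simple cycle at the front. Cutting it off cannot increase the weight, as its weight is
    nonnegative. *)
Lemma loop_erasure (R : realDomainType) (S : finType) (e : rel S) (f : S -> R) :
    (forall c, uniq c -> cycle e c -> 0 <= \sum_(y <- c) f y) ->
  forall x s, path e x s -> exists q, [/\ path e x q, uniq (x :: q)
    & \sum_(y <- x :: q) f y <= \sum_(y <- x :: s) f y].
Proof.
move=> f_ge0 x s; elim: s x => [|y s IHs] x; first by exists [::].
case/andP=> exy /IHs[q [pq uq le_q]].
have [xyq|xNyq] := boolP (x \in y :: q); last first.
  exists (y :: q); split; rewrite /= ?exy ?xNyq //=.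
  by rewrite big_cons [leRHS]big_cons lerD2l.
have {pq}: path e x (y :: q) by rewrite /= exy.
move: uq le_q; case: (splitPr xyq) => q1 q2 uq le_q.
rewrite -cat_rcons cat_path last_rcons => /andP[cq1 pq2].
move: uq; rewrite -cat_rcons cat_uniq => /and3P[uq1 /hasPn q1q2 uq2].
exists q2; split=> //=.
  by rewrite uq2 andbT; apply/negP => /q1q2; rewrite /= mem_rcons mem_head.
(* The discarded cycle is [x :: q1]; what remains is [x :: q2]. *)
have := f_ge0 (x :: q1); rewrite -(perm_uniq (permEl (perm_rcons x q1))) => /(_ uq1 cq1) ge0_q1.
rewrite [leRHS]big_cons (le_trans _ (lerD (lexx _) le_q)) //.
rewrite big_cat !big_cons /=; move: ge0_q1; rewrite big_cons; lra.
Qed.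

(** Loop erasure applies to the weight [w y - m], nonnegative on simple cycles. The simple path left
    over has at most [#|S|] vertices and [w] is nonnegative, so its shifted weight is at least
    [- m * #|S|]. *)
Lemma path_weight_ge (R : realDomainType) (S : finType) (e : rel S)
    (w : S -> R) (m : R) :
    0 <= m -> (forall x, 0 <= w x) ->
    (forall c, uniq c -> cycle e c -> m * (size c)%:R <= \sum_(y <- c) w y) ->
  forall x s, path e x s ->
    m * ((size s).+1%:R - #|S|%:R) <= \sum_(y <- x :: s) w y.
Proof.
move=> m_ge0 w_ge0 mean_ge x s pxs.
have sumE c : \sum_(y <- c) (w y - m) = \sum_(y <- c) w y - m * (size c)%:R.
  by rewrite sumrB big_const_seq count_predT iter_addr_0 mulr_natr.
have [c uc cc|q [_ uq]] := loop_erasure (e := e) (f := fun y => w y - m) _ pxs.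
  by rewrite sumE subr_ge0 mean_ge.
rewrite !sumE /=; have /card_uniqP cq := uq.
have qS : (size (x :: q))%:R <= #|S|%:R :> R by rewrite ler_nat -cq max_card.
have := ler_wpM2l m_ge0 qS; have : 0 <= \sum_(y <- x :: q) w y by apply: sumr_ge0.
by move=> /=; lra.
Qed.

(** A duplicate-free sequence has length at most [#|S|], so simple cycles form a finite nonempty
    family and the mean weight has a minimum. The inequality is cleared of the denominator [size c']
    so as to cover the empty [c']. *)
Lemma min_mean_cycle (R : realFieldType) (S : finType) (e : rel S)
    (w : S -> R) (c0 : seq S) :
    c0 != [::] -> uniq c0 -> cycle e c0 ->
  exists c, [/\ c != [::], uniq c, cycle e c & forall c', uniq c' -> cycle e c' ->
    (\sum_(y <- c) w y) / (size c)%:R * (size c')%:R <= \sum_(y <- c') w y].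
Proof.
move=> c0N uc0 cc0.
have size_c (c : seq S) : uniq c -> (size c <= #|S|)%N.
  by move=> /card_uniqP <-; apply: max_card.
pose P (c : #|S|.-bseq S) := [&& c != [::] :> seq S, uniq c & cycle e c].
pose F (c : #|S|.-bseq S) := (\sum_(y <- c) w y) / (size c)%:R.
have P0 : P (Bseq (size_c _ uc0)) by rewrite /P /= c0N uc0.
case: (@arg_minP _ _ _ _ P F P0) => c /and3P[cN uc cc] min_c.
exists (bseqval c); split=> // -[|x c'] uc' cc'; first by rewrite mulr0 big_nil.
rewrite -ler_pdivlMr ?ltr0n //.
by apply: (min_c (Bseq (size_c _ uc'))); rewrite /P /= -/(uniq (x :: c')) uc'.
Qed.

(** * Limits and upper limits from an error term of order 1/r *)

Lemma cvg_of_harmonic_bound (R : realType) (u : nat -> R) (d A : R) (N : nat) :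
    (forall r, (N <= r)%N -> `|u r - d| <= A / r.+1%:R) ->
  u @ \oo --> d.
Proof.
move=> bound; have cA (B : R) : (fun r => d + B * harmonic r) @ \oo --> d.
  rewrite -[X in _ --> X]addr0 -[X in d + X](mulr0 B).
  by apply: cvgD; [exact: cvg_cst|apply: cvgMr; exact: cvg_harmonic].
apply: (squeeze_cvgr _ (cA (- A)) (cA A)); exists N => // r /= Nr.
by have := bound r Nr; rewrite ler_distl /harmonic mulNr.
Qed.

(** Each tail supremum dominates [d - A / r.+1], which tends to [d]. Boundedness of [u] makes these
    suprema genuine and their sequence convergent. *)
Lemma limn_sup_ge (R : realType) (u : nat -> R) (d A : R) (N : nat) :
    (forall r, 0 <= u r <= 1) ->
    (forall r, (N <= r)%N -> d - A / r.+1%:R <= u r) ->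
  d <= limn_sup u.
Proof.
move=> u01 bound.
have ubu : has_ubound (range u) by exists 1 => _ [r _ <-]; case/andP: (u01 r).
have lbu : has_lbound (range u) by exists 0 => _ [r _ <-]; case/andP: (u01 r).
have cA : (fun r => d - A * harmonic r) @ \oo --> d.
  rewrite -[X in _ --> X]subr0 -[X in d - X](mulr0 A).
  by apply: cvgB; [exact: cvg_cst|apply: cvgMr; exact: cvg_harmonic].
rewrite -(cvg_lim _ cA) //; apply: ler_lim.
- by apply/cvg_ex; exists d.
- by apply/cvg_ex; eexists; exact: cvg_sups_inf.
exists N => // r /= Nr; apply: (le_trans (bound r Nr)).
apply: ub_le_sup; last by exists r => /=.
by case: ubu => M uM; exists M => _ [n _ <-]; apply: uM; exists n.
Qed.

(** * Adjacency in the strip and locality of identifying codes *)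

(** Replaces the quadratic adjacency test by a piecewise linear one, within reach of linear
    arithmetic. *)
Lemma sum_sqr_eq1 (a b : int) : (a ^+ 2 + b ^+ 2 == 1) = (`|a| + `|b| == 1)%N.
Proof.
suff : (a ^+ 2 + b ^+ 2 = 1) <-> (`|a| + `|b| = 1)%N.
  by move=> h; apply/eqP/eqP; apply h.
have sqr_ge (x : int) : `|x| <= x ^+ 2 by nia.
split=> [h|].
  have := sqr_ge a; have := sqr_ge b; case: (eqVneq a 0) => [a0|] ; nia.
by move=> h; have [|] : (a = 0 /\ (b = 1 \/ b = -1)) \/ (b = 0 /\ (a = 1 \/ a = -1));
  first lia; move=> [-> [->|->]].
Qed.

Lemma strip_adjE (k : nat) (u v : int * 'I_k) :
  strip_adj u v =
  (`|u.1 - v.1| + `|(u.2 : nat)%:Z - (v.2 : nat)%:Z| == 1)%N.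
Proof. exact: sum_sqr_eq1. Qed.

Lemma strip_adj_col (k : nat) (u v : int * 'I_k) :
  strip_adj u v -> v.1 - 1 <= u.1 <= v.1 + 1.
Proof. by rewrite strip_adjE; lia. Qed.

Lemma closed_nbhd_col (k : nat) (u v : int * 'I_k) :
  closed_nbhd (@strip_adj k) v u -> v.1 - 1 <= u.1 <= v.1 + 1.
Proof. by case=> [->|/strip_adj_col]; lia. Qed.

Lemma closed_nbhd_shift (k : nat) (t : int) (u v : int * 'I_k) :
  closed_nbhd (@strip_adj k) (v.1 + t, v.2) (u.1 + t, u.2) <->
  closed_nbhd (@strip_adj k) v u.
Proof.
case: u v => [ux uy] [vx vy]; rewrite /closed_nbhd /= !strip_adjE /=.
have -> : vx + t - (ux + t) = vx - ux by lia.
split=> -[]; first [by right | by move=> [? ->]; left; congr (_, _); lia].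
Qed.

(** If N[v] contains both horizontal neighbours of [u], then [v] lies in the column of [u], and then
    in its row. This code guarantees that the window digraph has a cycle. *)
Lemma identifying_codeT (k : nat) : identifying_code (@strip_adj k) setT.
Proof.
split=> [v|u v uv]; first by exists v; split=> //; left.
rewrite !setIT => nbhd_uv; apply: uv.
have nbhdE w : closed_nbhd (@strip_adj k) u w -> closed_nbhd (@strip_adj k) v w.
  by rewrite nbhd_uv.
have [] : closed_nbhd (@strip_adj k) v (u.1 + 1, u.2) /\
          closed_nbhd (@strip_adj k) v (u.1 - 1, u.2).
  by split; apply: nbhdE; right; rewrite strip_adjE /=; lia.
case: u v {nbhd_uv nbhdE} => [ux uy] [vx vy] r l.
have := closed_nbhd_col r; have := closed_nbhd_col l => /= ? ?.
have ? : ux = vx by lia.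
case: r => [[]|]; first lia.
by rewrite strip_adjE /= => ?; congr (_, _); [lia|apply: val_inj => /=; lia].
Qed.

Lemma identifying_code_local (k : nat) (C : set (int * 'I_k)) :
    (forall x : int, exists (D : set (int * 'I_k)) (x' : int),
       identifying_code (@strip_adj k) D /\
       forall (i : int) (y : 'I_k), 0 <= i <= 4 -> C (x + i, y) <-> D (x' + i, y)) ->
  identifying_code (@strip_adj k) C.
Proof.
move=> loc.
(* Neighbourhoods of vertices in columns x to x+2 lie in the five columns from x-1 to x+3. The
   translation [t] carries column x-1 to column [x'], where [D] shows the same pattern. *)
have locn (x : int) : exists (D : set (int * 'I_k)) (t : int),
    identifying_code (@strip_adj k) D /\
    forall v : int * 'I_k, x <= v.1 <= x + 2 ->
    forall u, closed_nbhd (@strip_adj k) v u -> C u <-> D (u.1 + t, u.2).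
  have [D [x' [DI CD]]] := loc (x - 1); exists D, (x' - x + 1); split=> // v xv [ux uy] uv.
  have := closed_nbhd_col uv => /= uv1.
  have := CD (ux - x + 1) uy.
  have -> : x - 1 + (ux - x + 1) = ux by lia.
  have -> : x' + (ux - x + 1) = ux + (x' - x + 1) by lia.
  by apply; lia.
have dom v : closed_nbhd (@strip_adj k) v `&` C !=set0.
  have [D [t [[domD _] CD]]] := locn v.1.
  have [[ux uy] []] := domD (v.1 + t, v.2).
  have -> : ux = (ux - t) + t by lia.
  move=> /(closed_nbhd_shift t (ux - t, uy)) uv Du; exists (ux - t, uy); split=> //.
  have vv (a : int) : a <= a <= a + 2 by lia.
  by apply/(CD v (vv _) _ uv).
have sep (u v : int * 'I_k) : u.1 <= v.1 -> u <> v ->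
    closed_nbhd (@strip_adj k) u `&` C <> closed_nbhd (@strip_adj k) v `&` C.
  (* Three or more columns apart, the closed neighbourhoods are disjoint, so equal traces would be
     empty, against [dom]. Closer pairs fit in one window. *)
  move=> uv1 uv CE; case: (leP v.1 (u.1 + 2)) => [vu|vu]; last first.
    have [[wx wy] [uw Cw]] := dom u.
    have [vw _] : (closed_nbhd (@strip_adj k) v `&` C) (wx, wy) by rewrite -CE.
    by have := closed_nbhd_col uw; have := closed_nbhd_col vw => /=; lia.
  have [D [t [[_ sepD] CD]]] := locn u.1.
  apply: (sepD (u.1 + t, u.2) (v.1 + t, v.2)).
    case: u v uv {uv1 CE vu CD} => [ux uy] [vx vy] uv [] ? ?.
    by apply: uv; congr (_, _) => //; lia.
  (* The trace of [D] at the translated vertex is the translate of the trace of [C], so equal traces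
     of [C] would contradict separation in [D]. *)
  have trace (a : int * 'I_k) : u.1 <= a.1 <= u.1 + 2 ->
      closed_nbhd (@strip_adj k) (a.1 + t, a.2) `&` D =
      [set w | (closed_nbhd (@strip_adj k) a `&` C) (w.1 - t, w.2)].
    move=> ua; apply/seteqP; split=> -[wx wy]; rewrite /=.
      have {1 2}-> : wx = (wx - t) + t by lia.
      move=> [/(closed_nbhd_shift t (wx - t, wy)) aw Dw]; split=> //.
      by apply/(CD a).
    move=> [aw Cw]; have {1 2}-> : wx = (wx - t) + t by lia.
    split; first exact/(closed_nbhd_shift t (wx - t, wy)).
    exact/(CD a _ (wx - t, wy)).
  by rewrite !trace ?CE //; lia.
split=> // u v uv; have [uv1|/ltW vu1] := leP u.1 v.1; first exact: sep.
by move=> /esym; apply: sep => // /esym.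
Qed.

(** * Counting in consecutive columns, and comparing balls with blocks of columns *)

Definition columns (k : nat) (x : int) (n : nat) : set (int * 'I_k) :=
  [set v | x <= v.1 < x + n%:Z].

Definition column_card (k : nat) (C : set (int * 'I_k)) (x : int) : nat :=
  #|[set y : 'I_k | `[< C (x, y) >]]%SET|.

(** An explicit finite image, from which both finiteness and the count column by column follow. *)
Lemma columnsE (k : nat) (C : set (int * 'I_k)) (x : int) (n : nat) :
  C `&` @columns k x n = [set` [fset ((x + (p.1 : nat)%:Z)%R, p.2) |
     p : 'I_n * 'I_k in [set p : 'I_n * 'I_k | `[< C ((x + (p.1 : nat)%:Z)%R, p.2) >]]%SET]%fset].
Proof.
apply/seteqP; split=> [[vx vy]|v].
  move=> [Cv]; rewrite /columns /= => xv.
  have vn : (`|vx - x| < n)%N by lia.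
  apply/imfsetP; exists (Ordinal vn, vy) => /=; last by congr (_, _); lia.
  by rewrite inE; apply/asboolP => /=; have -> : x + `|vx - x| = vx by lia.
move=> /imfsetP[/= p]; rewrite inE => /asboolP Cp ->.
by split=> //=; rewrite /columns /=; case: p {Cp} => -[i ilt] y /=; lia.
Qed.

Lemma finite_columns (k : nat) (x : int) (n : nat) : finite_set (@columns k x n).
Proof. by rewrite -[@columns k x n]setTI columnsE; exact: finite_fset. Qed.

Lemma card_columns_code (k : nat) (C : set (int * 'I_k)) (x : int) (n : nat) :
  #|` fset_set (C `&` @columns k x n)| = (\sum_(i < n) column_card C (x + (i : nat)%:Z))%N.
Proof.
rewrite columnsE set_fsetK card_imfset /=; last first.
  by move=> [i y] [j z] [] /addrI [] /val_inj -> ->.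
rewrite -cardE -sum1_card.
rewrite (eq_bigl (fun p : 'I_n * 'I_k => true && `[< C (x + (p.1 : nat)%:Z, p.2) >])).
  rewrite -(pair_big_dep predT (fun (i : 'I_n) (y : 'I_k) => `[< C (x + (i : nat)%:Z, y) >]) (fun _ _ => 1%N)).
  by apply: eq_bigr => i _; rewrite sum1dep_card.
by move=> p; rewrite inE.
Qed.

Lemma card_columns (k : nat) (x : int) (n : nat) :
  #|` fset_set (@columns k x n)| = (n * k)%N.
Proof.
rewrite -[@columns k x n]setTI card_columns_code (eq_bigr (fun _ => k)).
  by rewrite sum_nat_const card_ord.
move=> i _; rewrite /column_card -[RHS](card_ord k) -cardsT.
by apply: eq_card => y; rewrite !inE; apply/asboolP.
Qed.

Lemma subset_leq_card_fset_set (V : choiceType) (A B : set V) :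
  finite_set B -> A `<=` B -> (#|` fset_set A| <= #|` fset_set B|)%N.
Proof.
move=> finB AB; apply/fsubset_leq_card; rewrite -fset_set_sub //.
exact: sub_finite_set finB.
Qed.

Lemma graph_ball_sub (k : nat) (v0 : int * 'I_k) (r : nat) :
  graph_ball (@strip_adj k) v0 r `<=` @columns k (v0.1 - r%:Z) (r.*2.+1).
Proof.
have last_col (p : seq (int * 'I_k)) (v : int * 'I_k) : path (@strip_adj k) v p ->
    v.1 - (size p)%:Z <= (last v p).1 <= v.1 + (size p)%:Z.
  elim: p v => [|u p IHp] v /=; first by move=> _; lia.
  by move=> /andP[/strip_adj_col + /IHp]; lia.
move=> [vx vy] [p [/last_col pv vE pr]].
have {}pr : (@size (int * 'I_k) p <= r)%N := pr.
by move: pv; rewrite vE /columns /=; lia.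
Qed.

Lemma graph_ball_step (V : choiceType) (e : rel V) (v0 u v : V) (r : nat) :
  graph_ball e v0 r u -> e u v -> graph_ball e v0 r.+1 v.
Proof.
move=> [p [pp pu pr]] uv; exists (rcons p v).
by rewrite rcons_path pp pu uv last_rcons size_rcons.
Qed.

Lemma graph_ball_le (V : choiceType) (e : rel V) (v0 : V) (r s : nat) :
  (r <= s)%N -> graph_ball e v0 r `<=` graph_ball e v0 s.
Proof. by move=> rs v [p [? ? pr]]; exists p; split=> //; apply: leq_trans rs. Qed.

(** Walk vertically inside the column of [v0], in fewer than k steps, then horizontally in at most s
    steps. *)
Lemma sub_graph_ball (k : nat) (v0 : int * 'I_k) (s : nat) :
  @columns k (v0.1 - s%:Z) (s.*2.+1) `<=` graph_ball (@strip_adj k) v0 (s + k).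
Proof.
have vert (n : nat) (x : int) (y z : 'I_k) : (`|(y : nat)%:Z - (z : nat)%:Z| = n)%N ->
    graph_ball (@strip_adj k) (x, y) n (x, z).
  elim: n z => [|n IHn] z yz; last first.
    (* The row next to [z] on the side of [y]. *)
    have z'lt : ((if (y < z)%N then z.-1 else z.+1) < k)%N.
      by have := ltn_ord y; have := ltn_ord z; case: ifP; lia.
    apply: (@graph_ball_step _ _ _ (x, Ordinal z'lt)).
      by apply: IHn => /=; case: ifP z'lt; lia.
    by rewrite strip_adjE /=; case: ifP {z'lt}; lia.
  by exists [::]; split=> //=; congr (_, _); apply: val_inj => /=; lia.
have horiz (n : nat) (v : int * 'I_k) : (`|v.1 - v0.1| = n)%N ->
    graph_ball (@strip_adj k) v0 (n + k) v.
  elim: n v => [|n IHn] v vn.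
    apply: (@graph_ball_le _ _ _ `|(v0.2 : nat)%:Z - (v.2 : nat)%:Z|%N).
      by have := ltn_ord v0.2; have := ltn_ord v.2; lia.
    have {2}-> : v = (v0.1, v.2) by case: v vn => /= a b ?; congr (_, _); lia.
    by rewrite {1}(surjective_pairing v0); apply: vert.
  apply: (@graph_ball_step _ _ _ ((if v0.1 < v.1 then v.1 - 1 else v.1 + 1), v.2)).
    by apply: IHn => /=; case: ifP; lia.
  by rewrite strip_adjE /=; case: ifP; lia.
move=> v; rewrite /columns /= => sv; apply: graph_ball_le (horiz _ _ erefl).
by lia.
Qed.

(** * The digraph of four-column windows *)

Definition window (k : nat) (C : set (int * 'I_k)) (x : int) : {set 'I_4 * 'I_k} :=
  [set p : 'I_4 * 'I_k | `[< C (x + (p.1 : nat)%:Z, p.2) >]]%SET.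

(** Two successive windows show five columns, exactly the range of the locality criterion. Asking
    for an actual code that shows them makes every code a walk by construction. *)
Definition code_step (k : nat) : rel {set 'I_4 * 'I_k} := fun s t =>
  `[< exists C x, [/\ identifying_code (@strip_adj k) C, s = window C x
                    & t = window C (x + 1)] >].

Definition first_column_card (k : nat) (s : {set 'I_4 * 'I_k}) : nat :=
  #|[set y | (ord0, y) \in s]%SET|.

Lemma first_column_card_window (k : nat) (C : set (int * 'I_k)) (x : int) :
  first_column_card (window C x) = column_card C x.
Proof. by apply: eq_card => y; rewrite !inE /= addr0. Qed.

Lemma card_window_states (k : nat) : #|{set 'I_4 * 'I_k}| = (2 ^ (4 * k))%N.
Proof. by rewrite -cardsT -powersetT card_powerset cardsT card_prod !card_ord. Qed.

Lemma path_windows (k : nat) (C : set (int * 'I_k)) (x : int) (n : nat) :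
    identifying_code (@strip_adj k) C ->
  path (@code_step k) (window C x) [seq window C (x + i.+1%:Z) | i <- iota 0 n].
Proof.
move=> IC; elim: n x => [|n IHn] x //=.
apply/andP; split; first by apply/asboolP; exists C, x.
move: (IHn (x + 1)); rewrite -[1%N]/(1 + 0)%N iotaDl -map_comp.
by congr (path _ _ _); apply: eq_map => i /=; congr (window C _); lia.
Qed.

Lemma nth_cycle (T : eqType) (e : rel T) (x0 : T) (c : seq T) (i : nat) :
  cycle e c -> (i < size c)%N -> e (nth x0 c i) (nth x0 c (i.+1 %% size c)).
Proof.
case: c => [//|x p] /(pathP x0) cp /=; rewrite ltnS => ip.
have := cp i; rewrite size_rcons ltnS => /(_ ip).
rewrite -rcons_cons nth_rcons /= ltnS ip nth_rcons.
case: (ltnP i (size p)) => sp; first by rewrite modn_small.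
have -> : i = size p by lia.
by rewrite eqxx modnn.
Qed.

(** * Periodic codes from cycles of windows *)

(** All blocks of [l] consecutive terms have the same sum, and [n] terms are covered by [n %/ l + 1]
    such blocks. Multiplying by [l] keeps the bound in the naturals. *)
Lemma sum_period (l n : nat) (f : int -> nat) (x : int) :
    (0 < l)%N -> (forall y : int, f (y + l%:Z) = f y) ->
  ((\sum_(i < n) f (x + (i : nat)%:Z)%R) * l <=
   (n + l) * \sum_(i < l) f (i : nat)%:Z)%N.
Proof.
move=> l_gt0 f_per.
pose S (y : int) := (\sum_(i < l) f (y + (i : nat)%:Z)%R)%N.
(* Sliding the block by one loses [f y] and gains [f (y + l)], which are equal. *)
have S1 y : S (y + 1) = S y.
  rewrite /S; case: l l_gt0 f_per {S} => // l _ f_per.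
  rewrite big_ord_recr big_ord_recl addr0 addnC /=; congr (_ + _)%N.
    by apply: eq_bigr => i _; congr f; rewrite /bump /=; lia.
  by rewrite -[RHS](f_per y); congr f; lia.
have SE y : S y = S 0.
  elim/int_rect: y => [//|n0 IH|n0 IH].
    by rewrite -IH -(S1 n0%:Z); congr S; lia.
  by rewrite -IH -(S1 (- n0.+1%:Z)); congr S; lia.
have S_mul q (y : int) : (\sum_(i < q * l) f (y + (i : nat)%:Z)%R = q * S 0)%N.
  elim: q y => [|q IHq] y; first by rewrite !mul0n big_ord0.
  rewrite !mulSn big_split_ord; congr (_ + _)%N; first exact: SE.
  rewrite -(IHq (y + l%:Z)).
  by apply: eq_bigr => i _; rewrite PoszD addrA.
have <- : S 0 = (\sum_(i < l) f (i : nat)%:Z)%N.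
  by apply: eq_bigr => i _; rewrite add0r.
have le_q : (\sum_(i < n) f (x + (i : nat)%:Z)%R <= (n %/ l).+1 * S 0)%N.
  have n_le : (n <= (n %/ l).+1 * l)%N by rewrite ltnW // ltn_ceil.
  by rewrite -(S_mul _ x) -(subnKC n_le) big_split_ord leq_addr.
rewrite (leq_trans (leq_mul le_q (leqnn l))) // mulnAC leq_mul2r.
by rewrite mulSn addnC leq_add2r leq_trunc_div orbT.
Qed.

(** Only the first column of each state is used: the other three reappear as first columns of the
    next states. For nonempty [c] the remainder is a valid index, so the default [finset.set0] is
    never read. *)
Definition cycle_code (k : nat) (c : seq {set 'I_4 * 'I_k}) : set (int * 'I_k) :=
  [set v : int * 'I_k | (ord0, v.2) \in nth finset.set0 c `|(v.1 %% (size c)%:Z)%Z|%N].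

Lemma code_step_shift (k : nat) (s t : {set 'I_4 * 'I_k}) (i j : 'I_4) (y : 'I_k) :
  code_step s t -> (i : nat) = j.+1 -> ((i, y) \in s) = ((j, y) \in t).
Proof.
move=> /asboolP[D [x [_ -> ->]]] ij; rewrite !inE /= ij.
by congr `[< D (_, _) >]; lia.
Qed.

Section CycleCode.
Variables (k : nat) (c : seq {set 'I_4 * 'I_k}).
Hypotheses (c_neq0 : c != [::]) (cycle_c : cycle (@code_step k) c).

Let l := size c.
Let s (x : int) := nth finset.set0 c `|(x %% l%:Z)%Z|%N.

Let l_gt0 : (0 < l)%N. Proof. by rewrite lt0n size_eq0. Qed.

Let step_s x : code_step (s x) (s (x + 1)).
Proof.
have lt_xl : (`|(x %% l%:Z)%Z| < l)%N by have := @ltz_pmod x l%:Z; have := @modz_ge0 x l%:Z; lia.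
have := nth_cycle finset.set0 cycle_c lt_xl; rewrite -/l /s; congr (code_step _ (nth _ _ _)).
suff : (((`|(x %% l%:Z)%Z|).+1 %% l)%N%:Z = ((x + 1) %% l%:Z)%Z) by lia.
rewrite -modz_nat -modzDml; congr (modz _ _).
by have := @modz_ge0 x l%:Z; lia.
Qed.

Let s_shift x (i j : 'I_4) y : (i : nat) = j.+1 -> ((i, y) \in s x) = ((j, y) \in s (x + 1)).
Proof. exact: code_step_shift. Qed.

(** Each step along the cycle shifts the window by one column, so column [i] of [s x] is the first
    column of [s (x + i)]. *)
Let cycle_codeE x y (i : 'I_4) :
  cycle_code c (x + (i : nat)%:Z, y) <-> (i, y) \in s x.
Proof.
rewrite /cycle_code /= -/l -/(s _).
case: i => i; elim: i x => [|i IHi] x ilt /=.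
  by rewrite addr0 (_ : Ordinal ilt = ord0) //; apply: val_inj.
have ilt' : (i < 4)%N by lia.
rewrite (s_shift x y (i := Ordinal ilt) (j := Ordinal ilt')) // -IHi.
by rewrite -addrA (_ : 1 + i%:Z = i.+1).
Qed.

Lemma identifying_cycle_code : identifying_code (@strip_adj k) (cycle_code c).
Proof.
apply: identifying_code_local => x.
have /asboolP[D [x' [ID sx sx1]]] := step_s x; exists D, x'; split=> // i y i4.
(* The first four columns are read in [s x], the fifth as the last column of [s (x + 1)]; one code
   [D] shows both. *)
have [i3|i_eq4] : (`|i| < 4)%N \/ i = 4 by lia.
  have -> : i = (Ordinal i3 : nat)%:Z by rewrite /=; lia.
  by rewrite cycle_codeE sx inE; split=> /asboolP.
have -> : x + i = x + 1 + (ord_max : 'I_4) by rewrite /=; lia.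
have -> : x' + i = x' + 1 + (ord_max : 'I_4) by rewrite /=; lia.
by rewrite cycle_codeE sx1 inE; split=> /asboolP.
Qed.

Lemma periodic_cycle_code : periodic_identifying_code (size c) (cycle_code c).
Proof.
split; [exact: l_gt0|exact: identifying_cycle_code|].
have modDl (x : int) : ((x + l%:Z) %% l%:Z)%Z = (x %% l%:Z)%Z by rewrite modzDr.
apply/seteqP; split=> [_ [[x y] Cxy <-]|[x y] Cxy]; last exists (x - l%:Z, y).
- by rewrite /cycle_code /strip_shift /= -/l modDl.
- by rewrite /cycle_code /= -/l -modDl subrK.
- by rewrite /strip_shift /= subrK.
Qed.

Lemma column_card_cycle_code (x : int) :
  column_card (cycle_code c) x = first_column_card (s x).
Proof. by apply: eq_card => y; rewrite !inE; apply/asboolP/idP. Qed.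

Lemma column_cards_cycle_code_le (x : int) (n : nat) :
  ((\sum_(i < n) column_card (cycle_code c) (x + (i : nat)%:Z)%R) * size c <=
   (n + size c) * \sum_(t <- c) first_column_card t)%N.
Proof.
have -> : (\sum_(t <- c) first_column_card t =
    \sum_(i < l) column_card (cycle_code c) (i : nat)%:Z)%N.
  rewrite (big_nth finset.set0) big_mkord; apply: eq_bigr => i _.
  have il : 0 <= (i : nat)%:Z < l%:Z by rewrite ltz_nat (ltn_ord i).
  by rewrite column_card_cycle_code /s modz_small.
apply: sum_period => // y; rewrite !column_card_cycle_code /s.
by rewrite modzDr.
Qed.

End CycleCode.

(** * The lower bound valid for every identifying code *)

Lemma column_cards_ge (R : realFieldType) (k : nat) (m : R) :
    0 <= m ->
    (forall c, uniq c -> cycle (@code_step k) c ->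
       m * (size c)%:R <= \sum_(t <- c) (first_column_card t)%:R) ->
  forall C x n, identifying_code (@strip_adj k) C ->
    m * (n%:R - (2 ^ (4 * k))%:R) <= (\sum_(i < n) column_card C (x + (i : nat)%:Z)%R)%:R.
Proof.
move=> m_ge0 mean_ge C x [|n] IC.
  (* A walk has at least one vertex, so n = 0 is treated apart; the left side is then
     nonpositive. *)
  by rewrite big_ord0 sub0r mulrN oppr_le0 mulr_ge0.
have /= := path_weight_ge m_ge0 (fun t => ler0n R (first_column_card t)) mean_ge (path_windows x n IC).
rewrite card_window_states size_map size_iota.
move=> /le_trans; apply; rewrite natr_sum big_ord_recl addr0 big_cons first_column_card_window.
rewrite lerD2l big_map -{1}(subn0 n) -/(index_iota 0 n) big_mkord ler_sum // => i _.
by rewrite first_column_card_window.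
Qed.

(** * From column counts to proportions in balls *)

Lemma ball_ratio01 (R : realType) (V : choiceType) (e : rel V) (v0 : V)
    (C : set V) (r : nat) :
  finite_set (graph_ball e v0 r) -> 0 <= ball_ratio e R v0 C r <= 1.
Proof.
move=> finB; rewrite /ball_ratio divr_ge0 //=.
have le_card : (#|` fset_set (C `&` graph_ball e v0 r)|%:R
    <= #|` fset_set (graph_ball e v0 r)|%:R :> R).
  by rewrite ler_nat; apply: subset_leq_card_fset_set finB _; apply: subIsetr.
(* A zero denominator gives ratio 0, since the inverse of 0 is 0. *)
have [->|B_neq0] := eqVneq (#|` fset_set (graph_ball e v0 r)|) 0%N.
  by rewrite invr0 mulr0.
by rewrite ler_pdivrMr ?mul1r // ltr0n lt0n.
Qed.

Section BallRatio.
Variables (R : realType) (k : nat) (v0 : int * 'I_k) (C : set (int * 'I_k)).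
Variables (m L : R).
Hypotheses (m_ge0 : 0 <= m) (L_ge0 : 0 <= L).

Let k_gt0 : (0 < k)%N. Proof. exact: leq_ltn_trans (ltn_ord v0.2). Qed.

Let B r := graph_ball (@strip_adj k) v0 r.
(* A ball of radius r lies in 2r+1 columns and contains 2(r-k)+1 full ones;
   A / (r+1) bounds the resulting error on m / k, as r+1 <= (k+1)(2(r-k)+1). *)
Let A : R := m * (2 * k%:R + L) * k.+1%:R.

Let finite_ball r : finite_set (B r).
Proof. exact: sub_finite_set (@graph_ball_sub _ _ _) (finite_columns _ _ _). Qed.

Let card_ball_le r : (#|` fset_set (B r)| <= r.*2.+1 * k)%N.
Proof.
rewrite -(card_columns k (v0.1 - r%:Z)) subset_leq_card_fset_set //.
  exact: finite_columns.
exact: graph_ball_sub.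
Qed.

Let card_ball_ge s : (s.*2.+1 * k <= #|` fset_set (B (s + k))|)%N.
Proof.
rewrite -(card_columns k (v0.1 - s%:Z)) subset_leq_card_fset_set //.
exact: sub_graph_ball.
Qed.

Let error_le r (b : R) : (k <= r)%N -> b = #|` fset_set (B r)|%:R ->
  0 < b /\ m * (2 * k%:R + L) / b <= A / r.+1%:R.
Proof.
move=> kr bE; have := card_ball_ge (r - k); rewrite subnK // => b_ge.
have b_ge1 : (r - k).*2.+1%:R <= b.
  by rewrite bE ler_nat (leq_trans _ b_ge) // leq_pmulr.
have b_gt0 : 0 < b by apply: lt_le_trans b_ge1; rewrite ltr0n.
split=> //; rewrite ler_pdivlMr ?ltr0n // mulrAC ler_pdivrMr // /A -[leRHS]mulrA.
apply: ler_wpM2l; first by rewrite mulr_ge0 // addr_ge0 // mulr_ge0.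
apply: le_trans (ler_wpM2l (ler0n _ _) b_ge1).
by rewrite -natrM ler_nat; nia.
Qed.

(** The numerator is bounded below on the 2(r-k)+1 full columns in the ball, the denominator above
    by (2r+1)k. The two estimates differ by m(2k+L), which [error_le] absorbs. *)
Lemma ball_ratio_ge :
    (forall x n, m * (n%:R - L) <= (\sum_(i < n) column_card C (x + (i : nat)%:Z)%R)%:R) ->
  forall r, (k <= r)%N ->
    m / k%:R - A / r.+1%:R <= ball_ratio (@strip_adj k) R v0 C r.
Proof.
move=> C_ge r kr.
have [b_gt0 err] := error_le kr erefl.
rewrite lerBlDl -lerBlDr (le_trans _ err) // /ball_ratio -/(B r).
rewrite ler_pdivlMr // mulrBl divfK ?gt_eqF //.
have card_ge : m * ((r - k).*2.+1%:R - L) <= #|` fset_set (C `&` B r)|%:R.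
  apply: le_trans (C_ge (v0.1 - (r - k)%N%:Z) _) _.
  rewrite ler_nat -card_columns_code subset_leq_card_fset_set //.
    exact/finite_setIr/finite_ball.
  by apply: setIS; have := @sub_graph_ball k v0 (r - k); rewrite subnK.
have b_le : m / k%:R * #|` fset_set (B r)|%:R <= m * r.*2.+1%:R.
  rewrite mulrAC ler_pdivrMr ?ltr0n // -mulrA -natrM ler_wpM2l //.
  by rewrite ler_nat card_ball_le.
apply: le_trans (lerB b_le card_ge) _; rewrite -mulrBr ler_wpM2l //.
have : (r.*2.+1%:R : R) = (r - k).*2.+1%:R + 2 * k%:R.
  by rewrite -natrM -natrD; congr _%:R; lia.
by lra.
Qed.

(** The mirror estimate: numerator over all 2r+1 columns, denominator from the 2(r-k)+1 full ones,
    with the same gap m(2k+L). *)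
Lemma ball_ratio_le :
    (forall x n, (\sum_(i < n) column_card C (x + (i : nat)%:Z)%R)%:R <= m * (n%:R + L)) ->
  forall r, (k <= r)%N ->
    ball_ratio (@strip_adj k) R v0 C r <= m / k%:R + A / r.+1%:R.
Proof.
move=> C_le r kr.
have [b_gt0 err] := error_le kr erefl.
rewrite -lerBlDl (le_trans _ err) // /ball_ratio -/(B r).
rewrite ler_pdivlMr // mulrBl divfK ?gt_eqF //.
have card_le : #|` fset_set (C `&` B r)|%:R <= m * (r.*2.+1%:R + L).
  apply: le_trans (C_le (v0.1 - r%:Z) _).
  rewrite ler_nat -card_columns_code subset_leq_card_fset_set //.
    exact/finite_setIr/finite_columns.
  by apply: setIS; exact: graph_ball_sub.
have b_ge : m * (r - k).*2.+1%:R <= m / k%:R * #|` fset_set (B r)|%:R.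
  rewrite [leRHS]mulrAC ler_pdivlMr ?ltr0n // -mulrA -natrM ler_wpM2l //.
  by rewrite ler_nat; have := card_ball_ge (r - k); rewrite subnK.
apply: le_trans (lerB card_le b_ge) _; rewrite -mulrBr ler_wpM2l //.
have : (r.*2.+1%:R : R) = (r - k).*2.+1%:R + 2 * k%:R.
  by rewrite -natrM -natrD; congr _%:R; lia.
by lra.
Qed.

End BallRatio.

(** * Optimality of the code of a minimum mean cycle *)

Theorem theorem1 (R : realType) (k : nat) (k_ge1 : (1 <= k)%N)
    (v0 : int * 'I_k) :
  exists (C : set (int * 'I_k)) (l : nat),
    [/\ periodic_identifying_code l C,
        (l <= 2 ^ (4 * k))%N
      & has_density (@strip_adj k) v0 C (infimum_density (@strip_adj k) R v0)].
Proof.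
pose w (t : {set 'I_4 * 'I_k}) : R := (first_column_card t)%:R.
(* The full strip looks the same from every column, so its window carries a loop: a first simple
   cycle. *)
have [|||c [c_neq0 uc cc min_c]] :=
    @min_mean_cycle R _ (@code_step k) w [:: window setT 0] => //=.
  rewrite andbT; apply/asboolP; exists setT, 0; split=> //.
  exact: identifying_codeT.
pose m : R := (\sum_(t <- c) w t) / (size c)%:R.
have m_ge0 : 0 <= m by rewrite divr_ge0 // sumr_ge0.
have size_gt0 : (0 < size c)%N by rewrite lt0n size_eq0.
have size_le : (size c <= 2 ^ (4 * k))%N.
  by rewrite -card_window_states; have /card_uniqP <- := uc; exact: max_card.
pose L : R := (2 ^ (4 * k))%:R; pose d := m / k%:R.
pose A := m * (2 * k%:R + L) * k.+1%:R.
have fin_ball r : finite_set (graph_ball (@strip_adj k) v0 r).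
  exact: sub_finite_set (@graph_ball_sub _ _ _) (finite_columns _ _ _).
have ratio_ge C : identifying_code (@strip_adj k) C -> forall r, (k <= r)%N ->
    d - A / r.+1%:R <= ball_ratio (@strip_adj k) R v0 C r.
  move=> IC; apply: ball_ratio_ge => // x n.
  exact: column_cards_ge.
have upper_ge C : identifying_code (@strip_adj k) C ->
    d <= upper_density (@strip_adj k) R v0 C.
  move=> /ratio_ge; apply: limn_sup_ge => r; exact: ball_ratio01.
have per_c := periodic_cycle_code c_neq0 cc; have [_ Ic _] := per_c.
have cvg_c : ball_ratio (@strip_adj k) R v0 (cycle_code c) @ \oo --> d.
  apply: (@cvg_of_harmonic_bound _ _ _ A k) => r kr.
  rewrite ler_distl ratio_ge // ball_ratio_le // => x n.
  have le_sum := column_cards_cycle_code_le c_neq0 x n.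
  rewrite /m mulrAC ler_pdivlMr ?ltr0n //.
  have {le_sum} := le_sum; rewrite -(ler_nat R) !natrM natrD natr_sum => /le_trans; apply.
  (* The periodic count has error term [size c], at most [L], so the same [A] serves for both
     bounds. *)
  rewrite mulrC; apply: ler_wpM2l; first by rewrite sumr_ge0.
  by rewrite lerD2l ler_nat.
have [infE supE] := cvg_limn_inf_sup cvg_c.
have upper_c : upper_density (@strip_adj k) R v0 (cycle_code c) = d by [].
(* By [upper_ge], [d] is a lower bound over all codes, and the cycle code attains it, so the infimum
   is a minimum. *)
have inf_d : infimum_density (@strip_adj k) R v0 = d.
  apply/le_anti/andP; split; last first.
    by apply: lb_le_inf => [|_ [C IC <-]]; [exists d, (cycle_code c)|exact: upper_ge].
  apply: ge_inf; last by exists (cycle_code c).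
  by exists d => _ [C IC <-]; exact: upper_ge.
exists (cycle_code c), (size c); split=> //.
by rewrite inf_d; split.
Qed.
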